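(* Let $f$ be a convex function and $h$ an affine function. Given $\beta>0$, suppose that $x^*$ is a strong $\beta$-Lagrangian stationary point, with Lagrangian multiplier $y^*\in\mathbb{R}^m$, of the problem $\min_{x\in\mathbb{R}^n} f(x)$ subject to $h(x)=0$, $x\in\mathbb{S}$. If $\|x^*\|_0=s$, then $x^*$ is a local minimizer of the problem; if $\|x^*\|_0<s$, then $x^*$ is a global minimizer of the problem.
   Context: Let $n,m,s$ be positive integers with $0<s<n$; $f:\mathbb{R}^n\to\mathbb{R}$ and $h=(h_1,\dots,h_m)^\top:\mathbb{R}^n\to\mathbb{R}^m$ are twice continuously differentiable. $\|x\|_0$ is the number of nonzero components of $x$, and $\mathbb{S}=\{x\in\mathbb{R}^n:\|x\|_0\le s\}$. Lagrangian: $L(x,y)=f(x)-\langle y,h(x)\rangle$, $y\in\mathbb{R}^m$; $\nabla_xL$ is its gradient with respect to $x$. $\Pi_{\mathbb{S}}(z)=\arg\min_{w\in\mathbb{S}}\|z-w\|^2$ (in general a set). Definition: for $\beta>0$, $x^*\in\mathbb{R}^n$ is a strong $\beta$-Lagrangian stationary point of the problem with Lagrangian multiplier $y^*\in\mathbb{R}^m$ if $x^*=\Pi_{\mathbb{S}}(x^*-\beta\nabla_xL(x^*,y^* ))$ and $h(x^* )=0$. The equality with $\Pi_{\mathbb{S}}$ means that the projection set is the singleton $\{x^*\}$. *)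

(* Defs.v *)
From HB Require Import structures.
From mathcomp Require Import all_boot all_order all_algebra.
From mathcomp Require Import all_classical all_reals all_analysis.

Set Implicit Arguments.
Unset Strict Implicit.
Unset Printing Implicit Defensive.

Import Order.TTheory GRing.Theory Num.Theory.
Import numFieldNormedType.Exports.

Local Open Scope classical_set_scope.
Local Open Scope ring_scope.

(* Vectors of R^n are row vectors 'rV[R]_n. The library norm
   on 'rV[R]_n is the sup norm, so the Euclidean structure is given by [dotp];
   the topology is the same. *)

Definition dotp (R : realType) (n : nat) (u v : 'rV[R]_n) : R :=
  \sum_(i < n) u 0 i * v 0 i.

Definition sqnorm (R : realType) (n : nat) (u : 'rV[R]_n) : R := dotp u u.

Definition l0norm (R : realType) (n : nat) (x : 'rV[R]_n) : nat :=
  #|[pred i : 'I_n | x 0 i != 0]|.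

Definition sparse (R : realType) (n s : nat) : set 'rV[R]_n :=
  [set x | (l0norm x <= s)%N].

Definition gradient (R : realType) (n : nat) (f : 'rV[R]_n -> R)
    (x : 'rV[R]_n) : 'rV[R]_n :=
  \row_(i < n) 'D_(delta_mx 0 i) f x.

(* The Hessian is the Jacobian of the gradient. *)
Definition twice_cont_diff (R : realType) (n : nat) (f : 'rV[R]_n -> R) : Prop :=
  [/\ forall x, differentiable f x,
      forall x, differentiable (gradient f) x
    & continuous (jacobian (gradient f))].

Definition affine_map (R : realType) (n m : nat)
    (h : 'rV[R]_n -> 'rV[R]_m) : Prop :=
  exists (A : 'M[R]_(n, m)) (b : 'rV[R]_m), forall x, h x = x *m A + b.

Definition lagrangian (R : realType) (n m : nat) (f : 'rV[R]_n -> R)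
    (h : 'rV[R]_n -> 'rV[R]_m) (x : 'rV[R]_n) (y : 'rV[R]_m) : R :=
  f x - dotp y (h x).

Definition grad_lagrangian (R : realType) (n m : nat) (f : 'rV[R]_n -> R)
    (h : 'rV[R]_n -> 'rV[R]_m) (x : 'rV[R]_n) (y : 'rV[R]_m) : 'rV[R]_n :=
  gradient (fun x' => lagrangian f h x' y) x.

Definition proj_set (R : realType) (n : nat) (S : set 'rV[R]_n)
    (z : 'rV[R]_n) : set 'rV[R]_n :=
  [set w | S w /\ forall w', S w' -> sqnorm (z - w) <= sqnorm (z - w')].

Definition strong_stationary (R : realType) (n m s : nat)
    (f : 'rV[R]_n -> R) (h : 'rV[R]_n -> 'rV[R]_m) (beta : R)
    (x : 'rV[R]_n) (y : 'rV[R]_m) : Prop :=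
  proj_set (@sparse R n s) (x - beta *: grad_lagrangian f h x y) = [set x]
  /\ h x = 0.

Definition feasible (R : realType) (n m s : nat)
    (h : 'rV[R]_n -> 'rV[R]_m) : set 'rV[R]_n :=
  [set x | h x = 0] `&` @sparse R n s.

Definition global_minimizer (R : realType) (n : nat) (f : 'rV[R]_n -> R)
    (F : set 'rV[R]_n) (x : 'rV[R]_n) : Prop :=
  F x /\ forall z, F z -> f x <= f z.

Definition local_minimizer (R : realType) (n : nat) (f : 'rV[R]_n -> R)
    (F : set 'rV[R]_n) (x : 'rV[R]_n) : Prop :=
  F x /\ \forall z \near x, F z -> f x <= f z.

(* Main.v *)
(** With x the stationary point and g the x-gradient of the Lagrangian L at
    (x, y), moving x along a single coordinate i by -beta g_i annihilates
    the i-th term of the squared distance to x - beta g.  Hence g_i = 0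
    whenever that move stays in S: always if x has fewer than s nonzero
    components, and on the support of x otherwise.  As L(., y) is convex and
    agrees with f on feasible points, f(z) >= f(x) + <g, z - x> for feasible
    z.  The inner product vanishes in the first case, and in the second as
    soon as z is so close to x that its support contains, hence equals, that
    of x. *)
Require Import Defs.
From HB Require Import structures.
From mathcomp Require Import all_boot all_order all_algebra.
From mathcomp Require Import all_classical all_reals all_analysis.
From mathcomp Require Import ring lra.
Import Order.TTheory GRing.Theory Num.Theory.
Import numFieldNormedType.Exports.
Local Open Scope classical_set_scope.
Local Open Scope ring_scope.

(** For 0 < t <= 1, convexity on the segment from x to z bounds the difference quotient at t by
    [f z - f x]; the bound survives the limit from the right. *)
Lemma convex_derive_le (R : realType) (V : normedModType R) (f : V -> R)
    (x z : V) :
  convex_function [set: convex_lmodType V] f ->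
  derivable f x (z - x) -> 'D_(z - x) f x <= f z - f x.
Proof.
move=> fconv /cvg_dnbhs_at_right fder.
apply: (cvgr_to_le fder).
near=> t.
have t_gt0 : 0 < t by [].
have t_le1 : t <= 1 by near: t; exact: nbhs_right_ltW.
pose p : {i01 R} := Itv01 (ltW t_gt0) t_le1.
have := fconv p z x (in_setT _) (in_setT _).
have -> : conv p (z : convex_lmodType V) (x : convex_lmodType V)
    = t *: (z - x) + x :> V.
  rewrite /conv /= scalerBr /unstable.onem scalerBl scale1r.
  by rewrite addrA addrAC.
rewrite convRE /= /unstable.onem => le_conv.
rewrite /= -[_ *: _]/(_ * _) mulrC ler_pdivrMr//.
by move: le_conv; lra.
Unshelve. all: by end_near. Qed.

Lemma coord_eq0_of_proj {R : realType} {n : nat} {S : set 'rV[R]_n}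
    {x g : 'rV[R]_n} {beta : R} {i : 'I_n} :
  0 < beta -> proj_set S (x - beta *: g) x ->
  S (x - (beta * g 0 i) *: delta_mx 0 i) -> g 0 i = 0.
Proof.
move=> beta_gt0 [_ xmin] /xmin; rewrite /sqnorm /dotp.
(* The two distances differ only in term i, which is [(beta * g 0 i) ^+ 2] on the left and zero on
   the right. *)
rewrite (bigD1 i) //= [leRHS](bigD1 i) //= !mxE !eqxx /=.
rewrite [X in _ <= _ + X](eq_bigr
  (fun j => (x - beta *: g - x) 0 j * (x - beta *: g - x) 0 j)); last first.
  by move=> j ji; rewrite !mxE (negPf ji) andbF mulr0 subr0.
rewrite lerD2r => le0.
have : (beta * g 0 i) ^+ 2 <= 0 by move: le0; lra.
rewrite real_exprn_even_le0 ?num_real//= mulf_eq0 gt_eqF//=.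
by move/eqP.
Qed.

(** The support can gain only the index i, and does so only if i was outside it; the boolean counts
    this as 0 or 1. *)
Lemma l0norm_add_delta_le {R : realType} {n : nat} (x : 'rV[R]_n)
    (i : 'I_n) (t : R) :
  (l0norm (x + t *: delta_mx 0 i)%R <= (x 0 i == 0)%R + l0norm x)%N.
Proof.
rewrite /l0norm; case: (eqVneq (x 0 i) 0) => [xi0|xi0] /=.
  rewrite [X in (X + _)%N](_ : _ = (i \notin [pred j | x 0 j != 0]) :> nat);
    last first.
    by rewrite inE xi0 eqxx.
  rewrite -cardU1.
  apply/subset_leq_card/fintype.subsetP => j; rewrite !inE !mxE eqxx /=.
  by case: (eqVneq j i) => //= _; rewrite mulr0 addr0.
apply/subset_leq_card/fintype.subsetP => j; rewrite !inE !mxE eqxx /=.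
by case: (eqVneq j i) => [->//|_]; rewrite mulr0 addr0.
Qed.

Lemma dotp_mx {R : realType} {n : nat} (y u : 'rV[R]_n) :
  dotp y u = (u *m y^T) 0 0.
Proof. by rewrite mxE; apply: eq_bigr => i _; rewrite !mxE mulrC. Qed.

(** For t != 0 the affine term contributes the constant [dotp y (v *m A)] to the difference
    quotient. *)
Lemma derive_affine_lagrangian {R : realType} {n m : nat} (f : 'rV[R]_n -> R)
    (A : 'M[R]_(n, m)) (b y : 'rV[R]_m) (x v : 'rV[R]_n) :
  differentiable f x ->
  'D_v (fun x' => lagrangian f (fun u => u *m A + b) x' y) x
    = 'D_v f x - dotp y (v *m A).
Proof.
move=> /(diff_derivable (v := v)) fder.
apply: cvg_lim => //.
apply: (@cvg_trans _
  ((fun t => t^-1 *: ((f \o shift x) (t *: v) - f x) - dotp y (v *m A))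
     @ 0^')); last exact: cvgB fder (cvg_cst _).
apply: near_eq_cvg; near=> t.
have t_neq0 : t != 0 by near: t; exact: nbhs_dnbhs_neq.
rewrite /lagrangian /= mulmxDl -scalemxAl.
rewrite -[_ *: (_ - _)]/(_ * _) -[t^-1 *: _]/(_ * _) !dotp_mx.
rewrite !mulmxDl -scalemxAl !mxE.
by field.
Unshelve. all: by end_near. Qed.

(** Expand v in the standard basis: both terms on the right are linear in v, the first by
    differentiability of f. *)
Lemma dotp_grad_affine_lagrangian {R : realType} {n m : nat}
    (f : 'rV[R]_n -> R) (A : 'M[R]_(n, m)) (b y : 'rV[R]_m) (x v : 'rV[R]_n) :
  differentiable f x ->
  dotp (grad_lagrangian f (fun u => u *m A + b) x y) v
    = 'D_v f x - dotp y (v *m A).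
Proof.
move=> f_diff.
rewrite deriveE// {2 3}(row_sum_delta v) mulmx_suml !dotp_mx mulmx_suml summxE.
rewrite linear_sum -sumrB mxE; apply: eq_bigr => i _.
rewrite -!scalemxAl linearZ /= !mxE derive_affine_lagrangian// deriveE//.
by rewrite dotp_mx mxE mulrBr.
Qed.

Lemma support_subset_near {R : realType} {n : nat} (x : 'rV[R]_n) :
  \forall z \near x, forall i, x 0 i != 0 -> (z : 'rV[R]_n) 0 i != 0.
Proof.
apply: (@filter_forall _ 'I_n
  (fun i => [set z : 'rV[R]_n | x 0 i != 0 -> z 0 i != 0]) (nbhs x)) => i.
case: (eqVneq (x 0 i) 0) => [_|xi0]; first exact: nearW.
have := cvgr_neq0 _ (@coord_continuous R 1 n 0 i x) xi0.
by move=> /(_ (nbhs_filter x)); apply: filterS => z zi0 _.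
Qed.

Theorem theorem2p5 (R : realType) (n m s : nat)
    (n_gt0 : (0 < n)%N) (m_gt0 : (0 < m)%N)
    (s_gt0 : (0 < s)%N) (s_lt_n : (s < n)%N)
    (f : 'rV[R]_n -> R) (h : 'rV[R]_n -> 'rV[R]_m)
    (f_C2 : twice_cont_diff f)
    (h_C2 : forall j : 'I_m, twice_cont_diff (fun x => h x 0 j))
    (f_convex : convex_function [set: convex_lmodType 'rV[R]_n] f)
    (h_affine : affine_map h)
    (beta : R) (beta_gt0 : 0 < beta)
    (xstar : 'rV[R]_n) (ystar : 'rV[R]_m)
    (stat : strong_stationary s f h beta xstar ystar) :
  (l0norm xstar = s -> local_minimizer f (feasible s h) xstar) /\
  ((l0norm xstar < s)%N -> global_minimizer f (feasible s h) xstar).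
Proof.
case: f_C2 => f_diff _ _.
case: h_affine => A [b /funext h_eq].
case: stat => proj_eq hx0.
set g := grad_lagrangian f h xstar ystar in proj_eq.
have x_proj : proj_set (@sparse R n s) (xstar - beta *: g) xstar.
  by rewrite proj_eq.
have x_sparse : sparse s xstar by case: x_proj.
have x_feas : feasible s h xstar by [].
have f_ge z : h z = 0 -> dotp g (z - xstar) <= f z - f xstar.
  move=> hz0; have -> : dotp g (z - xstar) = 'D_(z - xstar) f xstar.
    rewrite /g h_eq dotp_grad_affine_lagrangian//.
    (* Both points satisfy the constraint, so the multiplier term vanishes. *)
    have -> : (z - xstar) *m A = h z - h xstar.
      by rewrite h_eq mulmxBl opprD addrACA subrr addr0.
    by rewrite hz0 hx0 subrr dotp_mx mul0mx mxE subr0.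
  by apply: convex_derive_le => //; exact: diff_derivable.
(* This bound covers both cases: every i if the support has fewer than s elements, and each i in the
   support if it has s. *)
have g0 i : ((xstar 0 i == 0)%R + l0norm xstar <= s)%N -> g 0 i = 0.
  move=> le_s; apply: (coord_eq0_of_proj beta_gt0 x_proj).
  by rewrite -scaleNr; exact: leq_trans (l0norm_add_delta_le _ _ _) le_s.
split=> [x_s|x_lt]; split=> //.
  near=> z => -[hz0 z_sparse].
  have x_sub_z : {subset [pred i | xstar 0 i != 0] <= [pred i | z 0 i != 0]}.
    by move=> i; rewrite !inE; move: i; near: z; exact: support_subset_near.
  (* The support of z has at most s elements and contains one of size s. *)
  have x_eq_z : [pred i | xstar 0 i != 0] =i [pred i | z 0 i != 0].
    apply/subset_cardP; last exact/fintype.subsetP.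
    apply/eqP; rewrite eqn_leq subset_leq_card; last exact/fintype.subsetP.
    by move: z_sparse; rewrite /sparse /= /l0norm -x_s.
  rewrite -subr_ge0; apply: le_trans (f_ge z hz0).
  (* Each term vanishes: off the support by [z - xstar], on it by g. *)
  rewrite /dotp big1// => i _; case: (eqVneq (xstar 0 i) 0) => [xi0|xi0].
    have := x_eq_z i; rewrite !inE xi0 eqxx /= => /esym/negbFE/eqP zi0.
    by rewrite !mxE zi0 xi0 subr0 mulr0.
  by rewrite g0 ?mul0r// (negPf xi0) x_s.
move=> z [hz0 _]; rewrite -subr_ge0; apply: le_trans (f_ge z hz0).
rewrite /dotp big1// => i _; rewrite g0 ?mul0r//.
by apply: leq_trans x_lt; case: (xstar 0 i == 0).
Unshelve. all: by end_near. Qed.
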